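(* (Strongly convex objective.) Suppose that $F:\mathbb{R}^d\to\mathbb{R}$ is twice continuously differentiable and that there exist constants $0<\mu\le L$ such that $\mu I\preceq\nabla^2 F(x)\preceq L I$ for all $x\in\mathbb{R}^d$. Let $x^*$ be the minimizer of $F$. Let $\{x_k\}$ be the iterates generated by the iteration $x_{k+1}=x_k-\alpha_k\nabla F_{S_k}(x_k)$, $\alpha_k>0$, with any $x_0\in\mathbb{R}^d$, where at each iteration $|S_k|$ is chosen such that the exact variance inner product test (with constant $\theta$) and the exact variance orthogonality test (with constant $\nu$) are satisfied, for any given constants $\theta>0$ and $\nu>0$. Then, if the steplength satisfies $$\alpha_k=\alpha\le\frac{1}{(1+\theta^2+\nu^2)L},$$ we have, for every $k$, $$\mathbb{E}[F(x_k)-F(x^* )]\le\rho^k\,(F(x_0)-F(x^* )),\qquad\text{where}\quad \rho=1-\mu\alpha .$$ In particular, if $\alpha$ takes its maximum value $\alpha=\frac{1}{(1+\theta^2+\nu^2)L}$, then $$\rho=1-\frac{\mu}{L(1+\theta^2+\nu^2)} .$$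
   Context: Setting. $F(x)=\mathbb{E}_{(z,y)\sim P}[f(x;z,y)]$ is the expected risk on $\mathbb{R}^d$, where $f$ is smooth in $x$ and $P$ is a probability distribution; $F_i(x)=f(x;z^i,y^i)$, where $(z^i,y^i)$ are random draws from $P$. For each fixed $x$, $\mathbb{E}[\nabla F_i(x)]=\nabla F(x)$ and $\mathbb{E}[\|\nabla F_i(x)\|^2]<\infty$, where $\mathbb{E}$ is over the draw $i$. The norm $\|\cdot\|$ is the $\ell_2$ norm, and $A\preceq B$ means that $B-A$ is symmetric positive semidefinite. Sampled gradient. At iterate $x_k$ a finite nonempty sample $S_k$ is drawn and $\nabla F_{S_k}(x_k)=\frac{1}{|S_k|}\sum_{i\in S_k}\nabla F_i(x_k)$. The size $|S_k|\ge 1$ is determined by the history (the starting point $x_0$, which is deterministic, and the samples $S_0,\dots,S_{k-1}$); given its size, $S_k$ consists of i.i.d. draws from $P$ independent of that history. Expectations. In the conclusions, $\mathbb{E}$ is the total expectation over all samples drawn. All expectations appearing are assumed to be well defined and finite. Exact variance inner product test (constant $\theta>0$) at $x_k$: $$\frac{\mathbb{E}\left[\left(\nabla F_i(x_k)^T\nabla F(x_k)-\|\nabla F(x_k)\|^2\right)^2\right]}{|S_k|}\le\theta^2\|\nabla F(x_k)\|^4 .$$ Exact variance orthogonality test (constant $\nu>0$) at $x_k$: $$\frac{\mathbb{E}\left[\left\|\nabla F_i(x_k)-\frac{\nabla F_i(x_k)^T\nabla F(x_k)}{\|\nabla F(x_k)\|^2}\nabla F(x_k)\right\|^2\right]}{|S_k|}\le\nu^2\|\nabla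 F(x_k)\|^2 .$$ In both tests the expectation is over the random draw $i$ (that is, $(z^i,y^i)\sim P$) with $x_k$ held fixed. If $\nabla F(x_k)=0$, the projection term $\frac{\nabla F_i(x_k)^T\nabla F(x_k)}{\|\nabla F(x_k)\|^2}\nabla F(x_k)$ is interpreted as $0$. *)

(* Defs.v *)
From mathcomp Require Import all_boot all_order all_algebra.
From mathcomp Require Import all_classical all_reals all_analysis.

Set Implicit Arguments.
Unset Strict Implicit.
Unset Printing Implicit Defensive.

Import Order.TTheory GRing.Theory Num.Theory.
Import numFieldNormedType.Exports.

Local Open Scope classical_set_scope.
Local Open Scope ring_scope.

Section Euclidean.
Context {R : realType} {d : nat}.
Implicit Types (u v : 'rV[R]_d) (A B : 'M[R]_d) (g : 'rV[R]_d -> R).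

Definition dot u v : R := (u *m v^T) 0 0.

(* The library norm `|u| on row vectors is the sup norm. It is used here only
   through the topology and the notion of differentiability it induces. *)
Definition l2norm u : R := Num.sqrt (dot u u).

Definition psd A : Prop := A^T = A /\ forall v, 0 <= dot (v *m A) v.

Definition loewner_le A B : Prop := psd (B - A).

Definition gradient g (x : 'rV[R]_d) : 'rV[R]_d :=
  \row_j 'D_(delta_mx 0 j) g x.

Definition hessian g (x : 'rV[R]_d) : 'M[R]_d := 'J (gradient g) x.

Definition C1 g : Prop :=
  (forall x, differentiable g x) /\ continuous (gradient g).

Definition C2 g : Prop :=
  [/\ forall x, differentiable g x,
      forall x, differentiable (gradient g) x &
      continuous (hessian g)].

End Euclidean.

(* A point xi : Xi stands for a data pair (z, y), so that f x xi is f(x; z, y). *)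
Section SampledGradient.
Context {R : realType} {d : nat} {dX : measure_display}
  {Xi : measurableType dX}.
Implicit Types (P : probability Xi R) (f : 'rV[R]_d -> Xi -> R).

Definition grad_at f (x : 'rV[R]_d) (xi : Xi) : 'rV[R]_d :=
  gradient (fun y => f y xi) x.

Definition sample_grad f (s : seq Xi) (x : 'rV[R]_d) : 'rV[R]_d :=
  (size s)%:R^-1 *: \sum_(xi <- s) grad_at f x xi.

Definition inner_product_test P f (F : 'rV[R]_d -> R) (theta : R)
    (x : 'rV[R]_d) (n : nat) : Prop :=
  ('E_P[fun xi => ((dot (grad_at f x xi) (gradient F x)
                    - l2norm (gradient F x) ^+ 2) ^+ 2)%R] * (n%:R^-1)%:E
   <= (theta ^+ 2 * l2norm (gradient F x) ^+ 4)%:E)%E.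

(* When gradient F x = 0 the projection term vanishes, since 0^-1 = 0. *)
Definition orthogonality_test P f (F : 'rV[R]_d -> R) (nu : R)
    (x : 'rV[R]_d) (n : nat) : Prop :=
  ('E_P[fun xi => (l2norm (grad_at f x xi
           - (dot (grad_at f x xi) (gradient F x)
              / l2norm (gradient F x) ^+ 2) *: gradient F x) ^+ 2)%R]
     * (n%:R^-1)%:E
   <= (nu ^+ 2 * l2norm (gradient F x) ^+ 2)%:E)%E.

End SampledGradient.

Section Sampling.
Context {R : realType} {dO dX : measure_display}
  {Omega : measurableType dO} {Xi : measurableType dX}.
Implicit Types (S : nat -> Omega -> seq Xi).

(* The k-th sample has an i-th draw (counting from 0), and it lies in B. *)
Definition draw_event S (k i : nat) (B : set Xi) : set Omega :=
  [set w | exists2 xi, onth (S k w) i = Some xi & B xi].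

(* The sigma-algebra generated by the random lists S 0, ..., S k.-1. Taking
   B = setT shows that it makes their sizes measurable. *)
Definition history S (k : nat) : set (set Omega) :=
  <<s [set E | exists j i B,
         [/\ (j < k)%N, measurable B & E = draw_event S j i B]] >>.

(* The last field says that, conditionally on the history and on its size, the
   k-th sample consists of i.i.d. draws from P. *)
Record adaptive_iid_sampling (Pr : probability Omega R)
    (P : probability Xi R) S : Prop := AdaptiveIidSampling {
  sample_measurable : forall k i (B : set Xi),
    measurable B -> measurable (draw_event S k i B);
  sample_nonempty : forall k w, (0 < size (S k w))%N;
  sample_size_history : forall k n,
    history S k [set w | size (S k w) = n];
  sample_iid : forall k n (A : set Omega) (B : 'I_n -> set Xi),
    history S k A -> A `<=` [set w | size (S k w) = n] ->
    (forall i, measurable (B i)) ->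
    Pr (A `&` [set w | forall i : 'I_n, draw_event S k i (B i) w])
    = (Pr A * \prod_(i < n) P (B i))%E
}.

End Sampling.

(* Main.v *)
From HB Require Import structures.
Require Import Defs.
From mathcomp Require Import all_boot all_order all_algebra.
From mathcomp Require Import all_classical all_reals all_analysis.
From mathcomp Require Import measurable_realfun ring lra.

(** Write G = gradient F (x k) and g_i = grad_at f (x k) xi_i for the draws of
the k-th sample, of size n. The step is x - alpha (G + N), where N is the
average over i < n of the deviations D_i = g_i - G. Given the history the D_i
are independent and centered, so the expectation of <G, N> vanishes and that of
|N|^2 is the average of the |D_i|^2 divided by n.

The two tests bound exactly this second moment. Splitting D_i along G and
orthogonally to G, Pythagoras gives
  |D_i|^2 = (<g_i, G> - |G|^2)^2 / |G|^2 + |g_i - (<g_i, G> / |G|^2) G|^2,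
and the tests say that the conditional means of the two terms are at most
n theta^2 |G|^2 and n nu^2 |G|^2 ([deviation_le]). Hence E|N|^2 <= c E|G|^2 with
c = theta^2 + nu^2 ([integral_mean_noise_sqr]).

The upper bound on the Hessian gives the descent inequality
  F (x - alpha v) <= F x - alpha <G, v> + L/2 alpha^2 |v|^2,
which for v = G + N and in expectation is at most
  E F x - alpha (1 - alpha L (1 + c) / 2) E|G|^2 <= E F x - alpha/2 E|G|^2
by the choice of alpha. Strong convexity enters only through the
Polyak-Lojasiewicz inequality |G|^2 >= 2 mu (F x - F xstar)
([polyak_lojasiewicz]), which turns this into the contraction by 1 - mu alpha
([expected_descent], [expected_gap_contracts]).

The probabilistic point is that the sample size is random, so everything is
done on each event where the size has a given value, under the restriction of
Pr to that event. There a draw is a point of law P independent of the history,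
and the freezing lemmas [freezing_ge0] and [freezing_centered] replace it by an
integral against P with the history held fixed; for the cross terms
<D_i, D_j> the i-th draw is added to what is held fixed ([fresh_draw_pair]).
The resulting inequalities are summed over the sizes
([ge0_integral_partition]). This requires the iterates to be measurable for the
history ([measurable_iterate]), which rests on the joint measurability of
sampled gradients, continuous in the point and measurable in the draw
([measurable_superposition]). The signed integrals are finite
because |G|^2 <= 2 L (F x - F xstar) ([gradient_le_gap]), whose expectation is
finite by induction on k. *)

Set Implicit Arguments.
Unset Strict Implicit.
Unset Printing Implicit Defensive.

Import Order.TTheory GRing.Theory Num.Theory.
Import numFieldNormedType.Exports.

Local Open Scope classical_set_scope.
Local Open Scope ring_scope.

(** * Euclidean geometry of row vectors *)

Section DotProduct.
Context {R : realType} {d : nat}.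
Implicit Types u v w : 'rV[R]_d.

Lemma dotE u v : dot u v = \sum_j u 0 j * v 0 j.
Proof. by rewrite /dot mxE; apply: eq_bigr => j _; rewrite mxE. Qed.

Lemma dotC u v : dot u v = dot v u.
Proof. by rewrite !dotE; apply: eq_bigr => j _; rewrite mulrC. Qed.

Lemma dotDl u v w : dot (u + v) w = dot u w + dot v w.
Proof. by rewrite /dot mulmxDl mxE. Qed.

Lemma dotZl a u v : dot (a *: u) v = a * dot u v.
Proof. by rewrite /dot -scalemxAl mxE. Qed.

Lemma dotDr u v w : dot u (v + w) = dot u v + dot u w.
Proof. by rewrite dotC dotDl !(dotC _ u). Qed.

Lemma dotZr a u v : dot u (a *: v) = a * dot u v.
Proof. by rewrite dotC dotZl dotC. Qed.

Lemma dotNl u v : dot (- u) v = - dot u v.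
Proof. by rewrite -scaleN1r dotZl mulN1r. Qed.

Lemma dotNr u v : dot u (- v) = - dot u v.
Proof. by rewrite dotC dotNl dotC. Qed.

Lemma dot0l v : dot 0 v = 0.
Proof. by rewrite /dot mul0mx mxE. Qed.

Lemma dot_suml (I : Type) (r : seq I) (g : I -> 'rV[R]_d) v :
  dot (\sum_(i <- r) g i) v = \sum_(i <- r) dot (g i) v.
Proof.
by elim/big_rec2: _ => [|i a b _ <-]; rewrite ?dot0l // dotDl.
Qed.

Lemma dot_sumr (I : Type) (r : seq I) (g : I -> 'rV[R]_d) v :
  dot v (\sum_(i <- r) g i) = \sum_(i <- r) dot v (g i).
Proof. by rewrite dotC dot_suml; apply: eq_bigr => i _; rewrite dotC. Qed.

Lemma dot_ge0 u : 0 <= dot u u.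
Proof. by rewrite dotE sumr_ge0 // => j _; rewrite -expr2 sqr_ge0. Qed.

Lemma l2norm_sqr u : l2norm u ^+ 2 = dot u u.
Proof. by rewrite sqr_sqrtr // dot_ge0. Qed.

Lemma dot_eq0 u : dot u u = 0 -> u = 0.
Proof.
rewrite dotE => /eqP.
rewrite psumr_eq0 => [/allP u0|j _]; last by rewrite -expr2 sqr_ge0.
apply/rowP => j; rewrite mxE.
by have := u0 j (mem_index_enum j); rewrite mulf_eq0 orbb => /eqP.
Qed.

Lemma normr_dot_le u v : `|dot u v| <= dot u u + dot v v.
Proof.
have := dot_ge0 (u + v); have := dot_ge0 (u - v).
rewrite !(dotDl, dotDr, dotNl, dotNr) (dotC v u) => h1 h2.
have := dot_ge0 u; have := dot_ge0 v.
by rewrite ler_norml => ? ?; apply/andP; split; lra.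
Qed.

End DotProduct.

(** * Second-order bounds along lines *)

Section Calculus.
Context {R : realType} {d : nat}.
Implicit Types (x y v : 'rV[R]_d) (g F : 'rV[R]_d -> R).

Lemma derive_gradient g x v :
  differentiable g x -> 'D_v g x = dot (gradient g x) v.
Proof.
move=> dg; rewrite deriveE // dotE {1}[v]row_sum_delta linear_sum.
apply: eq_bigr => j _; rewrite linearZ mxE deriveE //=.
by rewrite mulrC.
Qed.

(** Both difference quotients are the same function of the increment. *)
Lemma is_derive_line (W : normedModType R) (g : 'rV[R]_d -> W) x v t :
  differentiable g (x + t *: v) ->
  is_derive t (1 : R) (fun s => g (x + s *: v)) ('D_v g (x + t *: v)).
Proof.
move=> dg.
have E : (fun h : R => h^-1 *: (((fun s => g (x + s *: v)) \o shift t) (h *: 1)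
            - g (x + t *: v)))
       = (fun h : R => h^-1 *: ((g \o shift (x + t *: v)) (h *: v)
            - g (x + t *: v))).
  apply/funext => h /=; congr (_ *: (g _ - _)).
  by rewrite [h *: 1]mulr1 scalerDl addrCA.
split; first by rewrite /derivable E; exact: diff_derivable.
by rewrite /derive E.
Qed.

(** Bounding p'' from above bounds p' by integration from 0, and then p; each
integration is an application of the mean value theorem. *)
Lemma taylor2_le (p p' p'' : R -> R) (M : R) :
  (forall t, is_derive t (1 : R) p (p' t)) ->
  (forall t, is_derive t (1 : R) p' (p'' t)) ->
  (forall t, p'' t <= M) -> p 1 <= p 0 + p' 0 + M / 2.
Proof.
move=> dp dp' p''M.
have cont (q q' : R -> R) (a b : R) : (forall t, is_derive t (1 : R) q (q' t)) ->
    {within `[a, b], continuous q}.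
  move=> dq; apply: continuous_subspaceT => t.
  by apply/differentiable_continuous/derivable1_diffP; have := dq t => -[].
have p'_le t : 0 <= t -> p' t <= p' 0 + M * t.
  move=> t0.
  have [c _ E] := MVT_segment t0 (fun t _ => dp' t) (cont _ _ _ _ dp').
  have := ler_wpM2r t0 (p''M c); move: E; rewrite subr0; lra.
pose q t := p t - p' 0 * t - M / 2 * t ^+ 2.
have dq t : is_derive t (1 : R) q (p' t - p' 0 - M * t).
  have ? := dp t; rewrite /q; apply: is_derive_eq; rewrite /GRing.scale /=.
  by field.
have [c] := MVT_segment ler01 (fun t _ => dq t) (cont _ _ _ _ dq).
rewrite in_itv /= => /andP[c0 _]; rewrite /q => E.
by have := p'_le _ c0; lra.
Qed.

Section QuadraticBounds.
Variables (F : 'rV[R]_d -> R) (F_C2 : C2 F).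

Let is_derive_lineF x v t :
  is_derive t (1 : R) (fun s => F (x + s *: v)) (dot (gradient F (x + t *: v)) v).
Proof.
have [dF _ _] := F_C2.
by rewrite -derive_gradient //; exact: is_derive_line.
Qed.

(* Pairing with v is a continuous linear map, so it commutes with taking the
   derivative of the gradient along the line. *)
Let is_derive_line_gradient x v t :
  is_derive t (1 : R) (fun s => dot (gradient F (x + s *: v)) v)
    (dot (v *m hessian F (x + t *: v)) v).
Proof.
have [_ dG _] := F_C2.
pose l (u : 'rV[R]_d) : R := dot u v.
have l_linear : linear l by move=> a u w; rewrite /l dotDl dotZl.
pose lL : {linear 'rV[R]_d -> R} :=
  HB.pack l (GRing.isLinear.Build _ _ _ _ l l_linear).
have l_cont : continuous lL.
  rewrite (_ : (lL : 'rV[R]_d -> R) = fun u => \sum_j u 0 j * v 0 j); last first.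
    by apply/funext => u; rewrite -dotE.
  apply: (@continuous_big _ _ +%R) => // [|j _]; first exact: add_continuous.
  move=> u; apply: (@cvgMr_tmp R _ _ _ (fun u : 'rV[R]_d => u 0 j)).
    exact: (@nbhs_filter 'rV[R]_d u).
  exact: (@coord_continuous R 1 d 0 j u).
have dl (u : 'rV[R]_d) : differentiable lL u by exact: linear_differentiable.
have dlG z : differentiable (lL \o gradient F) z by exact: differentiable_comp.
have := is_derive_line (dlG (x + t *: v)).
rewrite (deriveE _ (dlG _)) diff_comp // diff_lin //= /l.
by rewrite -deriveE // deriveEjacobian.
Qed.

Lemma quadratic_upper_bound L x y :
  (forall z, loewner_le (hessian F z) L%:M) ->
  F y <= F x + dot (gradient F x) (y - x) + L / 2 * dot (y - x) (y - x).
Proof.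
move=> HL; set v := y - x.
have H t : dot (v *m hessian F (x + t *: v)) v <= L * dot v v.
  have [_ /(_ v)] := HL (x + t *: v).
  by rewrite mulmxBr mul_mx_scalar dotDl dotNl dotZl subr_ge0.
have := taylor2_le (is_derive_lineF x v) (is_derive_line_gradient x v) H.
by rewrite scale1r scale0r addr0 /v subrKC mulrAC.
Qed.

Lemma quadratic_lower_bound mu x y :
  (forall z, loewner_le mu%:M (hessian F z)) ->
  F x + dot (gradient F x) (y - x) + mu / 2 * dot (y - x) (y - x) <= F y.
Proof.
move=> Hmu; set v := y - x.
have H t : - dot (v *m hessian F (x + t *: v)) v <= - (mu * dot v v).
  have [_ /(_ v)] := Hmu (x + t *: v).
  by rewrite mulmxBr mul_mx_scalar dotDl dotNl dotZl subr_ge0 lerN2.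
have := taylor2_le (fun t => is_deriveN (is_derive_lineF x v t))
  (fun t => is_deriveN (is_derive_line_gradient x v t)) H.
rewrite !fctE scale1r scale0r addr0 {1}/v subrKC; lra.
Qed.

(** The quadratic lower bound, as a function of the increment, is minimal at
- G / mu; completing the square there gives the inequality. *)
Lemma polyak_lojasiewicz mu x y : 0 < mu ->
  (forall z, loewner_le mu%:M (hessian F z)) ->
  2 * mu * (F x - F y) <= dot (gradient F x) (gradient F x).
Proof.
move=> mu0 Hmu; have := quadratic_lower_bound x y Hmu.
move: (gradient F x) (y - x) => G v h.
(* the square that is completed *)
have := dot_ge0 (G + mu *: v).
rewrite !(dotDl, dotDr, dotZl, dotZr) (dotC v G).
nra.
Qed.

(** A gradient step of length 1 / L decreases F by |G|^2 / (2 L), and cannot go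
below the minimum. *)
Lemma gradient_le_gap L x y : 0 < L ->
  (forall z, loewner_le (hessian F z) L%:M) -> (forall z, F y <= F z) ->
  dot (gradient F x) (gradient F x) <= 2 * L * (F x - F y).
Proof.
move=> L0 HL ymin; set G := gradient F x.
have := quadratic_upper_bound x (x - L^-1 *: G) HL.
have -> : x - L^-1 *: G - x = - (L^-1 *: G) by rewrite addrC addKr.
rewrite -/G dotNl !dotNr opprK !dotZl dotZr.
have := ymin (x - L^-1 *: G); set q := dot G G; set z := F (_ - _) => h1 h2.
have h3 : F y <= F x - q / L / 2.
  apply: le_trans h1 (le_trans h2 _); rewrite le_eqVlt; apply/orP; left; apply/eqP.
  by field; rewrite gt_eqF.
have -> : q = 2 * L * (q / L / 2) by field; rewrite gt_eqF.
by rewrite ler_pM2l ?mulr_gt0 //; lra.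
Qed.

End QuadraticBounds.
End Calculus.

(** * Measurability of superpositions and derivatives *)

Section Measurability.
Context {R : realType} {d : nat} {dT : measure_display} {T : measurableType dT}.

(** A Caratheodory function composed with a measurable point is measurable:
rounding the coordinates of x t down to multiples of 1 / m.+1 leaves countably
many values, on each of which only measurability of h in its second argument
matters, and continuity in the first argument recovers the limit in m. *)
Lemma measurable_superposition (h : 'rV[R]_d -> T -> R) (x : T -> 'rV[R]_d) :
  (forall q, measurable_fun setT (h q)) -> (forall t, continuous (h^~ t)) ->
  (forall j, measurable_fun setT (fun t => x t 0 j)) ->
  measurable_fun setT (fun t => h (x t) t).
Proof.
move=> mh ch mx.
pose q (m : nat) t : 'rV[int]_d := \row_j Num.floor (m.+1%:R * x t 0 j).
pose r (m : nat) (z : 'rV[int]_d) : 'rV[R]_d := \row_j ((z 0 j)%:~R / m.+1%:R).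
have mq m z : measurable [set t | q m t = z].
  have -> : [set t | q m t = z] = \bigcap_(j in [set: 'I_d])
      ((fun t => m.+1%:R * x t 0 j) @^-1` `[(z 0 j)%:~R, (z 0 j + 1)%:~R[).
    apply/seteqP; split=> [t <- j _|t zt] /=.
      by rewrite in_itv /= mxE floor_itv.
    apply/rowP => j; rewrite mxE; apply: floor_def.
    by have := zt j I; rewrite /= in_itv.
  apply: fin_bigcap_measurable => // j _.
  by rewrite -[X in measurable X]setTI; apply: measurable_funM => //; exact: mx.
apply: (measurable_fun_cvg (h := fun m t => h (r m (q m t)) t)) => [m|t _].
- pose E i : set T := [set t | unpickle i = Some (q m t)].
  have mE i : measurable (E i).
    rewrite /E; case: (unpickle i) => [z|]; last first.
      by rewrite (_ : [set _ | _] = set0) //; apply/seteqP; split.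
    rewrite (_ : [set _ | _] = [set t | q m t = z]) //.
    by apply/seteqP; split=> t /= [->].
  have -> : [set: T] = \bigcup_i E i.
    apply/seteqP; split=> // t _; exists (pickle (q m t)) => //=.
    by rewrite /E /= pickleK.
  apply/measurable_fun_bigcup => // i.
  case zi : (unpickle i : option 'rV[int]_d) => [z|]; last first.
    have -> : E i = set0 by apply/seteqP; split=> // t; rewrite /E /= zi.
    exact: measurable_fun_set0.
  apply: (eq_measurable_fun (h (r m z))).
    by move=> t; rewrite inE /E /= zi => -[->].
  exact: measurable_funTS.
- have : r m (q m t) @[m --> \oo] --> x t.
    apply/cvg_ballP => e e0; near=> m.
    split=> // i j; rewrite ord1 !mxE /ball /=.
    have m0 : 0 < m.+1%:R :> R by rewrite ltr0n.
    have /andP[fl fu] := floor_itv (m.+1%:R * x t 0 j).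
    have me : m.+1%:R^-1 < e.
      by near: m; exact: (near_infty_natSinv_lt (PosNum e0)).
    rewrite ger0_norm; last by rewrite subr_ge0 ler_pdivrMr // [leRHS]mulrC.
    apply: lt_trans me; rewrite -(ltr_pM2l m0) mulrBr mulfV ?gt_eqF //.
    rewrite [ltLHS]addrC mulrCA mulfV ?gt_eqF // mulr1.
    by move: fu; rewrite intrD; lra.
  by move=> rx; exact: (cvg_comp _ _ rx (ch t (x t))).
Unshelve. all: by end_near. Qed.

(** The derivative is the pointwise limit of difference quotients along the
increments 1 / m.+1. *)
Lemma measurable_derive (f : 'rV[R]_d -> T -> R) (x v : 'rV[R]_d) :
  (forall y, measurable_fun setT (f y)) ->
  (forall t, derivable (f^~ t) x v) ->
  measurable_fun setT (fun t => 'D_v (f^~ t) x).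
Proof.
move=> mf df.
pose u m : R := m.+1%:R^-1.
apply: (measurable_fun_cvg
  (h := fun m t => (u m)^-1 * (f (u m *: v + x) t - f x t))) => [m|t _].
  by apply: measurable_funM => //; exact: measurable_funB.
have /cvgr_dnbhsP := df t : _ @ 0^' --> 'D_v (f^~ t) x.
apply; split=> [m|]; first by rewrite invr_eq0 pnatr_eq0.
exact: cvg_harmonic.
Qed.

End Measurability.

(** * Freezing the past in an integral *)

Section ImageMeasure.
Local Open Scope ereal_scope.
Context {R : realType} {d1 d2 : measure_display}
  {T1 : measurableType d1} {T2 : measurableType d2}.
Variables (m : {finite_measure set T1 -> \bar R}) (U : T1 -> T2).
Hypothesis mU : measurable_fun setT U.

(** The measurability proof is a phantom argument: it makes the measure
structure of the image inferable from the term. *)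
Definition image_measure & measurable_fun setT U : set T2 -> \bar R :=
  pushforward m U.

Let measurable_preimage B : measurable B -> measurable (U @^-1` B).
Proof. by move=> mB; rewrite -[X in measurable X]setTI; exact: mU. Qed.

Let image_measure0 : image_measure mU set0 = 0.
Proof. by rewrite /image_measure /pushforward preimage_set0 measure0. Qed.

Let image_measure_ge0 B : 0 <= image_measure mU B.
Proof. exact: measure_ge0. Qed.

Let image_measure_sigma_additive : semi_sigma_additive (image_measure mU).
Proof.
move=> B mB tB mUB; rewrite /image_measure /pushforward preimage_bigcup.
apply: measure_semi_sigma_additive => [n||].
- exact: measurable_preimage.
- apply/trivIsetP => /= i j _ _ ij; rewrite -preimage_setI.
  by move/trivIsetP : tB => /(_ _ _ _ _ ij) ->//; rewrite preimage_set0.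
- by rewrite -preimage_bigcup; exact: measurable_preimage.
Qed.

HB.instance Definition _ := isMeasure.Build _ _ _ (image_measure mU)
  image_measure0 image_measure_ge0 image_measure_sigma_additive.

Let image_measure_fin : fin_num_fun (image_measure mU).
Proof.
by move=> B mB; apply: fin_num_measure; exact: measurable_preimage.
Qed.

HB.instance Definition _ := @Measure_isFinite.Build _ T2 R (image_measure mU)
  image_measure_fin.

End ImageMeasure.

Section Freezing.
Local Open Scope ereal_scope.
Context {R : realType} {dO dT dX : measure_display} {Om : measurableType dO}
  {T : measurableType dT} {Xi : measurableType dX}.
Implicit Types (m : {finite_measure set Om -> \bar R}) (P : probability Xi R)
  (U : Om -> T) (Y : Om -> Xi).

(** Under m normalized, Y has law P and is independent of U. The mass of m is
arbitrary, as for the restriction of a probability to an event. *)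
Definition fresh_draw m P U Y : Prop := forall B C, measurable B -> measurable C ->
  m (U @^-1` B `&` Y @^-1` C) = m (U @^-1` B) * P C.

Section Joint.
Variables (m : {finite_measure set Om -> \bar R}) (P : probability Xi R)
  (U : Om -> T) (Y : Om -> Xi).
Hypotheses (mU : measurable_fun setT U) (mY : measurable_fun setT Y)
  (UY : fresh_draw m P U Y).

Let mUY : measurable_fun setT (fun w => (U w, Y w)).
Proof. exact: measurable_fun_pair. Qed.

(** Independence identifies the joint law on rectangles, hence everywhere. *)
Lemma image_measure_pair (A : set (T * Xi)) : measurable A ->
  (image_measure m mU \x P) A = image_measure m mUY A.
Proof.
apply: product_measure_unique => B C mB mC.
by rewrite -UY.
Qed.

Lemma freezing_ge0 (phi : T * Xi -> \bar R) :
  measurable_fun setT phi -> (forall p, 0 <= phi p) ->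
  \int[m]_w phi (U w, Y w) = \int[m]_w \int[P]_y phi (U w, y).
Proof.
move=> mphi phi0.
have F0 u : 0 <= \int[P]_y phi (u, y) by exact: integral_ge0.
have mF : measurable_fun setT (fun u => \int[P]_y phi (u, y)).
  exact: measurable_fun_fubini_tonelli_F.
transitivity (\int[image_measure m mUY]_p phi p).
  by rewrite ge0_integral_pushforward.
transitivity (\int[image_measure m mU \x P]_p phi p).
  by apply/esym/eq_measure_integral => A mA _; exact: image_measure_pair.
rewrite fubini_tonelli1 // ge0_integral_pushforward // => u _; exact: F0.
Qed.

(** The integrability hypothesis is on m alone: it passes to the product measure
since both are the same joint law, which is what Fubini needs. *)
Lemma freezing_centered (phi : T * Xi -> \bar R) :
  measurable_fun setT phi -> m.-integrable setT (fun w => phi (U w, Y w)) ->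
  (forall u, \int[P]_y phi (u, y) = 0) ->
  \int[m]_w phi (U w, Y w) = 0.
Proof.
move=> mphi iphi phi0.
have iprod : (image_measure m mU \x P)%E.-integrable setT phi.
  apply/integrableP; split => //.
  have -> : \int[image_measure m mU \x P]_p `|phi p|
          = \int[image_measure m mUY]_p `|phi p|.
    by apply: eq_measure_integral => A mA _; exact: image_measure_pair.
  rewrite ge0_integral_pushforward //; last exact: measurableT_comp.
  by have /integrableP[_] := iphi.
transitivity (\int[image_measure m mUY]_p phi p).
  by rewrite integral_pushforward.
transitivity (\int[image_measure m mU \x P]_p phi p).
  by apply/esym/eq_measure_integral => A mA _; exact: image_measure_pair.
rewrite -integral12_prod_meas1 //.
by under eq_integral => u _ do rewrite /fubini_F phi0; rewrite integral0.
Qed.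

End Joint.
End Freezing.

Section FreshDrawPair.
Local Open Scope ereal_scope.
Context {R : realType} {dO dT dX : measure_display} {Om : measurableType dO}
  {T : measurableType dT} {Xi : measurableType dX}.
Implicit Types (m : {finite_measure set Om -> \bar R}) (P : probability Xi R)
  (U : Om -> T) (Y Z : Om -> Xi).

(** For fixed D, both sides of the independence property are finite measures of
the event concerning (U, Y), and the assumption makes them agree with one and
the same product measure on rectangles. *)
Lemma fresh_draw_pair m P U Y Z :
  measurable_fun setT U -> measurable_fun setT Y -> measurable_fun setT Z ->
  (forall B C D, measurable B -> measurable C -> measurable D ->
     m (U @^-1` B `&` Y @^-1` C `&` Z @^-1` D) = m (U @^-1` B) * P C * P D) ->
  fresh_draw m P (fun w => (U w, Y w)) Z.
Proof.
move=> mU mY mZ UYZ A D mA mD.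
have mUY : measurable_fun setT (fun w => (U w, Y w)) by exact: measurable_fun_pair.
have mZD : measurable (Z @^-1` D) by rewrite -[X in measurable X]setTI; exact: mZ.
have PD0 : (0 <= fine (P D))%R by rewrite fine_ge0.
have PDE : (fine (P D))%:E = P D by rewrite fineK // fin_num_measure.
(* the law of (U, Y) on the event that Z lies in D *)
pose mD' : {finite_measure set Om -> \bar R} := mrestr m mZD.
have UYE B C : measurable B -> measurable C ->
    m (U @^-1` B `&` Y @^-1` C) = m (U @^-1` B) * P C.
  move=> mB mC; have := UYZ B C setT mB mC measurableT.
  by rewrite preimage_setT setIT probability_setT mule1.
have UZE B : measurable B -> m (U @^-1` B `&` Z @^-1` D) = m (U @^-1` B) * P D.
  move=> mB; have := UYZ B setT D mB measurableT mD.
  by rewrite preimage_setT setIT probability_setT mule1.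
transitivity ((image_measure mD' mU \x P) A).
  rewrite (product_measure_unique (m' := image_measure mD' mUY)) // => B C mB mC.
  rewrite /= /image_measure /pushforward /mD' /= /mrestr UZE // muleAC.
  exact: UYZ.
rewrite (product_measure_unique
  (m' := mscale (NngNum PD0) (image_measure m mUY))) //.
  by rewrite [RHS]muleC -[X in X * _]PDE.
move=> B C mB mC; rewrite -[RHS]/(m (U @^-1` B `&` Z @^-1` D) * P C) UZE //.
rewrite -[LHS]/((fine (P D))%:E * m (U @^-1` B `&` Y @^-1` C)).
by rewrite PDE UYE // muleC muleAC.
Qed.

End FreshDrawPair.

(** * Second moment of the deviation at a fixed point *)

Section FixedPoint.
Context {R : realType} {d : nat} {dX : measure_display} {Xi : measurableType dX}.
Variables (P : probability Xi R) (g : Xi -> 'rV[R]_d) (G : 'rV[R]_d).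
Hypothesis mg : forall j, measurable_fun setT (fun y => g y 0 j).

Lemma measurable_dot {dT} {T : measurableType dT} (u v : T -> 'rV[R]_d) :
  (forall j, measurable_fun setT (fun t => u t 0 j)) ->
  (forall j, measurable_fun setT (fun t => v t 0 j)) ->
  measurable_fun setT (fun t => dot (u t) (v t)).
Proof.
move=> mu mv; under eq_fun => t do rewrite dotE.
by apply: measurable_sum => j; exact: measurable_funM.
Qed.

Lemma measurable_coordD {dT} {T : measurableType dT} (u v : T -> 'rV[R]_d) :
  (forall j, measurable_fun setT (fun t => u t 0 j)) ->
  (forall j, measurable_fun setT (fun t => v t 0 j)) ->
  forall j, measurable_fun setT (fun t => (u t + v t) 0 j).
Proof.
move=> mu mv j; under eq_fun => t do rewrite mxE.
exact: measurable_funD.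
Qed.

Lemma measurable_coordZ {dT} {T : measurableType dT} (a : T -> R) (u : T -> 'rV[R]_d) :
  measurable_fun setT a -> (forall j, measurable_fun setT (fun t => u t 0 j)) ->
  forall j, measurable_fun setT (fun t => (a t *: u t) 0 j).
Proof.
move=> ma mu j; under eq_fun => t do rewrite mxE.
exact: measurable_funM.
Qed.

Lemma measurable_coord_sum {dT} {T : measurableType dT} (I : Type) (r : seq I)
    (u : I -> T -> 'rV[R]_d) :
  (forall i j, measurable_fun setT (fun t => u i t 0 j)) ->
  forall j, measurable_fun setT (fun t => (\sum_(i <- r) u i t) 0 j).
Proof.
move=> mu j; under eq_fun => t do rewrite summxE.
by apply: measurable_sum => i; exact: mu.
Qed.

(** Pythagoras. The identity survives v = 0: both the quotients and the first
term vanish then, as 0^-1 = 0. *)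
Lemma dot_sub_decomposition (u v : 'rV[R]_d) :
  dot (u - v) (u - v) = (dot u v - dot v v) ^+ 2 / dot v v +
    dot (u - (dot u v / dot v v) *: v) (u - (dot u v / dot v v) *: v).
Proof.
rewrite !(dotDl, dotDr, dotNl, dotNr, dotZl, dotZr) (dotC v u).
have [/dot_eq0 ->|v0] := eqVneq (dot v v) 0.
  by rewrite dotC !dot0l invr0; ring.
by field.
Qed.

(** The two tests control the components of the deviation along G and orthogonal
to G, so together they control all of it. *)
Lemma deviation_le (theta nu : R) (n : nat) : (0 < n)%N ->
  ('E_P[fun y => ((dot (g y) G - l2norm G ^+ 2) ^+ 2)%R] * (n%:R^-1)%:E
     <= (theta ^+ 2 * l2norm G ^+ 4)%:E)%E ->
  ('E_P[fun y => (l2norm (g y - (dot (g y) G / l2norm G ^+ 2) *: G) ^+ 2)%R]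
     * (n%:R^-1)%:E <= (nu ^+ 2 * l2norm G ^+ 2)%:E)%E ->
  (\int[P]_y (dot (g y - G) (g y - G))%:E
     <= (n%:R * (theta ^+ 2 + nu ^+ 2) * dot G G)%:E)%E.
Proof.
move=> n0; have n0' : 0 < n%:R :> R by rewrite ltr0n.
rewrite !unlock (_ : 4%N = (2 * 2)%N) // exprM !l2norm_sqr.
rewrite !lee_pdivrMr // => ip.
under eq_integral => y _ do rewrite l2norm_sqr.
move=> orth.
have mG j : measurable_fun [set: Xi] (fun=> G 0 j) by [].
have mgG := measurable_dot mg mG.
have q0 := dot_ge0 G; set q := dot G G in q0 ip orth *.
under eq_integral => y _ do rewrite dot_sub_decomposition -/q EFinD mulrC EFinM.
have mIP : measurable_fun [set: Xi] (fun y => ((dot (g y) G - q) ^+ 2)%:E).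
  by apply/measurable_EFinP; apply: measurable_funX; exact: measurable_funB.
have mO : measurable_fun [set: Xi]
    (fun y => (dot (g y - (dot (g y) G / q) *: G)
                   (g y - (dot (g y) G / q) *: G))%:E).
  have mo j : measurable_fun setT (fun y => (g y - (dot (g y) G / q) *: G) 0 j).
    under eq_fun => y do rewrite -scaleNr.
    apply: measurable_coordD => // {}j; apply: measurable_coordZ => //.
    by apply: measurable_funN; exact: measurable_funM.
  by apply/measurable_EFinP; exact: measurable_dot.
have qV0 : (0 <= (q^-1)%:E)%E by rewrite lee_fin invr_ge0.
rewrite ge0_integralD //; last 3 first.
- by move=> y _; rewrite mule_ge0 // lee_fin sqr_ge0.
- exact: emeasurable_funM.
- by move=> y _; rewrite lee_fin dot_ge0.
rewrite ge0_integralZl //; last by move=> y _; rewrite lee_fin sqr_ge0.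
apply: le_trans (leeD (lee_wpmul2l qV0 ip) orth) _.
rewrite -!EFinM -EFinD lee_fin le_eqVlt; apply/orP; left; apply/eqP.
have [->|q1] := eqVneq q 0; first by rewrite invr0; ring.
by field.
Qed.

(** A finite second moment makes every coordinate integrable, so the integral
can be taken coordinate by coordinate. *)
Lemma integral_dot_centered (v : 'rV[R]_d) :
  (forall j, 'E_P[fun y => (g y 0 j)%R] = (G 0 j)%:E)%E ->
  ('E_P[fun y => (l2norm (g y) ^+ 2)%R] < +oo)%E ->
  (\int[P]_y (dot v (g y - G))%:E = 0)%E.
Proof.
rewrite unlock => gG g2.
have ig2 : P.-integrable setT (EFin \o fun y => 1 + dot (g y) (g y)).
  have i1 : P.-integrable setT (EFin \o cst (1 : R)).
    exact: finite_measure_integrable_cst.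
  suff i2 : P.-integrable setT (EFin \o fun y => dot (g y) (g y)).
    exact: (integrableD measurableT i1 i2).
  apply/integrableP; split; first by apply/measurable_EFinP; exact: measurable_dot.
  under eq_integral => y _ do rewrite /= ger0_norm ?dot_ge0 // -l2norm_sqr.
  exact: g2.
have ig j : P.-integrable setT (EFin \o fun y => g y 0 j).
  apply: (le_integrable _ _ _ ig2) => // [|y _]; first exact/measurable_EFinP.
  rewrite lee_fin /= [leRHS]ger0_norm ?addr_ge0 ?dot_ge0 //.
  rewrite dotE (bigD1 j) //= addrA ler_wpDr ?sumr_ge0 // => [i _|].
    by rewrite -expr2 sqr_ge0.
  by rewrite -expr2 ler_norml; have := sqr_ge0 (g y 0 j); nra.
have iD j : P.-integrable setT (fun y => (g y 0 j)%:E - (G 0 j)%:E)%E.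
  apply: (integrableB measurableT (ig j)).
  exact: (finite_measure_integrable_cst _ (G 0 j) measurableT).
under eq_integral => y _.
  rewrite dotE -sumEFin.
  under eq_bigr => j _ do rewrite !mxE EFinM EFinB.
  over.
rewrite integral_sum //=; last by move=> j; exact: integrableZl.
rewrite big1 // => j _.
rewrite integralZl //.
have -> : (\int[P]_y ((g y 0 j)%:E - (G 0 j)%:E) =
    \int[P]_y (g y 0 j)%:E - \int[P]_y (G 0 j)%:E)%E.
  exact: (integralB measurableT (ig j)
    (finite_measure_integrable_cst _ (G 0 j) measurableT)).
rewrite gG.
rewrite integral_cst // [X in (_ * (_ - _ * X))%E](_ : _ = 1%E).
  by rewrite mule1 subee // mule0.
exact: probability_setT.
Qed.

End FixedPoint.

(** * Averaged noise and the expected decrease of one step *)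

Section Noise.
Context {R : realType} {d : nat} {dO dT dX : measure_display}
  {Om : measurableType dO} {T : measurableType dT} {Xi : measurableType dX}.
Variables (m : {finite_measure set Om -> \bar R}) (P : probability Xi R)
  (U : Om -> T) (n : nat) (Y : 'I_n -> Om -> Xi).
Variables (G : T -> 'rV[R]_d) (D : T -> Xi -> 'rV[R]_d) (c : R).
Hypotheses (n_gt0 : (0 < n)%N) (c_ge0 : 0 <= c) (mU : measurable_fun setT U)
  (mY : forall i, measurable_fun setT (Y i))
  (fresh1 : forall i, fresh_draw m P U (Y i))
  (fresh2 : forall i j, i != j -> fresh_draw m P (fun w => (U w, Y i w)) (Y j)).
Hypotheses (mG : forall j, measurable_fun setT (fun u => G u 0 j))
  (mD : forall j, measurable_fun setT (fun p : T * Xi => D p.1 p.2 0 j))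
  (D_centered : forall u v, (\int[P]_y (dot v (D u y))%:E = 0)%E)
  (D_moment : {ae m, forall w, (\int[P]_y (dot (D (U w) y) (D (U w) y))%:E
     <= (n%:R * c * dot (G (U w)) (G (U w)))%:E)%E})
  (G_integrable : m.-integrable setT (EFin \o fun w => dot (G (U w)) (G (U w)))).

Let Gw w := G (U w).
Let Dw i w := D (U w) (Y i w).
Definition mean_noise w : 'rV[R]_d := n%:R^-1 *: \sum_(i < n) D (U w) (Y i w).

Let mGw j : measurable_fun setT (fun w => Gw w 0 j).
Proof. exact: (measurableT_comp (mG j)). Qed.

Let mDw i j : measurable_fun setT (fun w => Dw i w 0 j).
Proof.
exact: (measurableT_comp (mD j) (measurable_fun_pair mU (mY i))).
Qed.

Let integral_Dw_sqr i :
  (\int[m]_w (dot (Dw i w) (Dw i w))%:E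
   <= (n%:R * c)%:E * \int[m]_w (dot (Gw w) (Gw w))%:E)%E.
Proof.
have mDD : measurable_fun setT
    (fun p : T * Xi => (dot (D p.1 p.2) (D p.1 p.2))%:E).
  by apply/measurable_EFinP; exact: measurable_dot.
rewrite (freezing_ge0 mU (mY i) (fresh1 i) mDD) /=; last first.
  by move=> p; rewrite lee_fin dot_ge0.
have nc0 : (0 <= (n%:R * c)%:E)%E by rewrite lee_fin mulr_ge0.
rewrite -ge0_integralZl //; last 2 first.
- by apply/measurable_EFinP; exact: measurable_dot.
- by move=> w _; rewrite lee_fin dot_ge0.
apply: ae_ge0_le_integral => //.
- by move=> w _; apply: integral_ge0 => y _; rewrite lee_fin dot_ge0.
- suff mF : measurable_fun setT (fun u => \int[P]_y (dot (D u y) (D u y))%:E)%E.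
    exact: (measurableT_comp mF mU).
  by apply: (measurable_fun_fubini_tonelli_F _ mDD) => p; rewrite lee_fin dot_ge0.
- by move=> w _; rewrite mule_ge0 // lee_fin dot_ge0.
- apply: emeasurable_funM => //.
  by apply/measurable_EFinP; exact: measurable_dot.
- by apply: filterS D_moment => w DwE _; rewrite -EFinM.
Qed.

Let integrable_DwD i : m.-integrable setT (EFin \o fun w => dot (Dw i w) (Dw i w)).
Proof.
apply/integrableP; split; first by apply/measurable_EFinP; exact: measurable_dot.
under eq_integral => w _ do rewrite /= ger0_norm ?dot_ge0 //.
apply: le_lt_trans (integral_Dw_sqr i) _.
rewrite lte_mul_pinfty // ?lee_fin ?mulr_ge0 //.
have /integrableP[_] := G_integrable.
by under eq_integral => w _ do rewrite /= ger0_norm ?dot_ge0 //.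
Qed.

Let integrable_dot (u v : Om -> 'rV[R]_d) :
  (forall j, measurable_fun setT (fun w => u w 0 j)) ->
  (forall j, measurable_fun setT (fun w => v w 0 j)) ->
  m.-integrable setT (EFin \o fun w => dot (u w) (u w)) ->
  m.-integrable setT (EFin \o fun w => dot (v w) (v w)) ->
  m.-integrable setT (EFin \o fun w => dot (u w) (v w)).
Proof.
move=> mu mv iu iv.
apply: (le_integrable _ _ _ (integrableD measurableT iu iv)) => // [|w _].
  by apply/measurable_EFinP; exact: measurable_dot.
rewrite lee_fin [leRHS]ger0_norm ?addr_ge0 ?dot_ge0 //.
exact: normr_dot_le.
Qed.

Let integral_GwD i : (\int[m]_w (dot (Gw w) (Dw i w))%:E = 0)%E.
Proof.
apply: (freezing_centered mU (mY i) (fresh1 i)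
  (phi := fun p => (dot (G p.1) (D p.1 p.2))%:E)) => //=.
- apply/measurable_EFinP; apply: measurable_dot => // j.
  exact: (measurableT_comp (mG j) measurable_fst).
- exact: (integrable_dot mGw (mDw i)).
Qed.

Let integral_DwD i j : i != j -> (\int[m]_w (dot (Dw i w) (Dw j w))%:E = 0)%E.
Proof.
move=> ij.
have mUY : measurable_fun setT (fun w => (U w, Y i w)) by exact: measurable_fun_pair.
apply: (freezing_centered mUY (mY j) (fresh2 ij)
  (phi := fun p => (dot (D p.1.1 p.1.2) (D p.1.1 p.2))%:E)) => //=.
- apply/measurable_EFinP; apply: measurable_dot => k.
    exact: (measurableT_comp (mD k) measurable_fst).
  exact: (measurableT_comp (mD k) (measurable_fun_pair
    (measurableT_comp measurable_fst measurable_fst) measurable_snd)).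
- exact: (integrable_dot (mDw i) (mDw j)).
Qed.

Lemma measurable_mean_noise j : measurable_fun setT (fun w => mean_noise w 0 j).
Proof.
under eq_fun => w do rewrite mxE summxE.
by apply: measurable_funM => //; apply: measurable_sum => i; exact: mDw.
Qed.

Let mean_noise_sqrE w : (dot (mean_noise w) (mean_noise w))%:E =
  ((n%:R^-1 * n%:R^-1)%:E *
    \sum_(i < n) \sum_(j < n) (dot (Dw i w) (Dw j w))%:E)%E.
Proof.
rewrite dotZl dotZr dot_suml mulrA EFinM -sumEFin; congr (_ * _)%E.
by apply: eq_bigr => i _; rewrite dot_sumr -sumEFin.
Qed.

Lemma integrable_mean_noise_sqr :
  m.-integrable setT (EFin \o fun w => dot (mean_noise w) (mean_noise w)).
Proof.
have iD i j := integrable_dot (mDw i) (mDw j) (integrable_DwD i) (integrable_DwD j).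
apply: (eq_integrable _ (fun w => (n%:R^-1 * n%:R^-1)%:E *
    \sum_(i < n) \sum_(j < n) (dot (Dw i w) (Dw j w))%:E)%E) => //.
  by move=> w _; rewrite /= mean_noise_sqrE.
apply: integrableZl => //; apply: integrable_sum => // i _.
by apply: integrable_sum => // j _; exact: iD.
Qed.

Lemma integrable_dot_mean_noise :
  m.-integrable setT (EFin \o fun w => dot (G (U w)) (mean_noise w)).
Proof.
exact: (integrable_dot mGw measurable_mean_noise G_integrable
  integrable_mean_noise_sqr).
Qed.

Lemma integral_dot_mean_noise : (\int[m]_w (dot (G (U w)) (mean_noise w))%:E = 0)%E.
Proof.
have iGD i := integrable_dot mGw (mDw i) G_integrable (integrable_DwD i).
under eq_integral => w _.
  rewrite dotZr dot_sumr EFinM -sumEFin.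
  over.
rewrite integralZl //; last by apply: integrable_sum => // i _; exact: iGD.
rewrite integral_sum //.
by rewrite big1 ?mule0 // => i _; exact: integral_GwD.
Qed.

(** Of the n^2 terms of the expanded square only the n diagonal ones have a
nonzero integral, each at most n c times that of |G|^2; the factor n^-2 of the
average leaves c. *)
Lemma integral_mean_noise_sqr :
  (\int[m]_w (dot (mean_noise w) (mean_noise w))%:E
   <= c%:E * \int[m]_w (dot (G (U w)) (G (U w)))%:E)%E.
Proof.
under eq_integral => w _ do rewrite mean_noise_sqrE.
have iD i j := integrable_dot (mDw i) (mDw j) (integrable_DwD i) (integrable_DwD j).
have iDs i : m.-integrable setT (fun w => \sum_(j < n) (dot (Dw i w) (Dw j w))%:E)%E.
  by apply: integrable_sum => // j _; exact: iD.
rewrite integralZl //; last by apply: integrable_sum => // i _; exact: iDs.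
rewrite integral_sum //.
under eq_bigr => i _.
  rewrite integral_sum; [|by []|by move=> j; exact: iD].
  rewrite (bigD1 i) //= big1 ?adde0; last first.
    by move=> j ji; rewrite integral_DwD // eq_sym.
  over.
set I := (\int[m]_w (dot (G (U w)) (G (U w)))%:E)%E.
apply: (@le_trans _ _ ((n%:R^-1 * n%:R^-1)%:E * \sum_(i < n) ((n%:R * c)%:E * I))%E).
  apply: lee_wpmul2l; first by rewrite lee_fin mulr_ge0 ?invr_ge0.
  by apply: lee_sum => i _; exact: integral_Dw_sqr.
have <- : (fine I)%:E = I.
  by rewrite fineK //; apply: (integrable_fin_num _ G_integrable).
rewrite -EFinM sumEFin -!EFinM lee_fin sumr_const card_ord -[X in _ * X]mulr_natl.
rewrite le_eqVlt; apply/orP; left; apply/eqP.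
by field; rewrite pnatr_eq0 -lt0n.
Qed.

(** The descent inequality is integrated after expanding it in |G|^2, <G, N> and
|N|^2: the middle term vanishes, the last is at most c times the first, and the
step-length condition leaves at least half of al |G|^2. *)
Lemma expected_descent (h h' : Om -> R) (al L mu : R) :
  0 < mu -> 0 < L -> 0 < al -> al * L * (1 + c) <= 1 ->
  measurable_fun setT h' -> (forall w, 0 <= h' w) ->
  m.-integrable setT (EFin \o h) ->
  (forall w, 2 * mu * h w <= dot (G (U w)) (G (U w))) ->
  (forall w, h' w <= h w - al * dot (G (U w)) (G (U w) + mean_noise w)
     + L / 2 * (al ^+ 2 * dot (G (U w) + mean_noise w) (G (U w) + mean_noise w))) ->
  (\int[m]_w (h' w)%:E <= (1 - mu * al)%:E * \int[m]_w (h w)%:E)%E.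
Proof.
move=> mu0 L0 al0 alL mh' h'0 ih PL desc.
(* coefficients of |G|^2, <G, N> and |N|^2 *)
pose b0 := al - L / 2 * al ^+ 2; pose b1 := L * al ^+ 2 - al.
pose b2 := L / 2 * al ^+ 2.
have b2_0 : 0 <= b2 by rewrite /b2 mulr_ge0 ?sqr_ge0 ?divr_ge0 ?ltW.
have iGG : m.-integrable setT (EFin \o fun w => - b0 * dot (G (U w)) (G (U w))).
  exact: (integrableZl measurableT (- b0) G_integrable).
have iGN : m.-integrable setT (EFin \o fun w => b1 * dot (G (U w)) (mean_noise w)).
  exact: (integrableZl measurableT b1 integrable_dot_mean_noise).
have iNN : m.-integrable setT (EFin \o fun w => b2 * dot (mean_noise w) (mean_noise w)).
  exact: (integrableZl measurableT b2 integrable_mean_noise_sqr).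
have i1 := integrableD measurableT ih iGG.
have i2 := integrableD measurableT iGN iNN.
have i3 := integrableD measurableT i1 i2.
apply: (@le_trans _ _ (\int[m]_w ((h w)%:E + (- b0 * dot (G (U w)) (G (U w)))%:E
   + ((b1 * dot (G (U w)) (mean_noise w))%:E
     + (b2 * dot (mean_noise w) (mean_noise w))%:E)))%E).
  apply: ge0_le_integral => //.
  - by move=> w _; rewrite lee_fin.
  - exact/measurable_EFinP.
  - exact: measurable_int i3.
  - move=> w _; rewrite lee_fin; apply: le_trans (desc w) _.
    rewrite !(dotDl, dotDr) (dotC (mean_noise w)) /b0 /b1 /b2.
    by rewrite le_eqVlt; apply/orP; left; apply/eqP; field.
have -> : (\int[m]_w ((h w)%:E + (- b0 * dot (G (U w)) (G (U w)))%:E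
   + ((b1 * dot (G (U w)) (mean_noise w))%:E
     + (b2 * dot (mean_noise w) (mean_noise w))%:E))
   = \int[m]_w (h w)%:E + (- b0)%:E * \int[m]_w (dot (G (U w)) (G (U w)))%:E
   + (b1%:E * \int[m]_w (dot (G (U w)) (mean_noise w))%:E
     + b2%:E * \int[m]_w (dot (mean_noise w) (mean_noise w))%:E))%E.
  rewrite -(integralZl measurableT G_integrable).
  rewrite -(integralZl measurableT integrable_dot_mean_noise).
  rewrite -(integralZl measurableT integrable_mean_noise_sqr).
  rewrite -(integralD measurableT ih iGG) -(integralD measurableT iGN iNN).
  exact: (integralD measurableT i1 i2).
rewrite integral_dot_mean_noise mule0 add0e.
have NN := integral_mean_noise_sqr.
have IG : (\int[m]_w (dot (G (U w)) (G (U w)))%:E)%E \is a fin_num.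
  exact: (integrable_fin_num _ G_integrable).
have IH : (\int[m]_w (h w)%:E)%E \is a fin_num by exact: (integrable_fin_num _ ih).
have PLI : ((2 * mu)%:E * \int[m]_w (h w)%:E
    <= \int[m]_w (dot (G (U w)) (G (U w)))%:E)%E.
  rewrite -integralZl //; apply: le_integral => //.
  - exact: integrableZl.
  - by move=> w _; rewrite -EFinM lee_fin.
have IN0 : (\int[m]_w (dot (mean_noise w) (mean_noise w))%:E)%E \is a fin_num.
  exact: (integrable_fin_num _ integrable_mean_noise_sqr).
move: NN PLI; rewrite -(fineK IG) -(fineK IH) -(fineK IN0) -!EFinM -!EFinD !lee_fin.
have : 0 <= fine (\int[m]_w (dot (G (U w)) (G (U w)))%:E)%E.
  by apply: fine_ge0; apply: integral_ge0 => w _; rewrite lee_fin dot_ge0.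
move: (fine _) (fine _) (fine _) => hh nn gg gg0 nn_le hh_le.
have nn_le' := ler_wpM2l b2_0 nn_le.
(* al * gg / 2 is the factor that turns the step-length condition into the
   bound al^2 * L * (1 + c) / 2 * gg <= al / 2 * gg *)
have ag0 : 0 <= al * gg / 2 by rewrite divr_ge0 // mulr_ge0 // ltW.
have := ler_wpM2l ag0 alL; have := ler_wpM2l (ltW al0) hh_le.
rewrite /b0; move: nn_le'; rewrite /b2; lra.
Qed.

End Noise.

(** * Restricting to the value of the sample size *)

Section Restriction.
Context {R : realType} {dO : measure_display} {Om : measurableType dO}.
Variable Pr : probability Om R.

Lemma ae_mrestr (A : set Om) (mA : measurable A) (Q : Om -> Prop) :
  {ae Pr, forall w, A w -> Q w} -> {ae mrestr Pr mA, forall w, Q w}.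
Proof.
move=> [N [mN PrN QN]]; exists (N `|` ~` A); split.
- by apply: measurableU => //; exact: measurableC.
- rewrite /= /mrestr setIUl setICl setU0; apply/eqP.
  rewrite -measure_le0 -PrN le_measure ?inE //; exact: measurableI.
- move=> w /= Qw; have [Aw|] := pselect (A w); last by right.
  by left; apply: QN => /= /(_ Aw).
Qed.

Lemma ge0_integral_partition (A : nat -> set Om) (mA : forall n, measurable (A n))
    (g : Om -> \bar R) : trivIset setT A -> \bigcup_n A n = setT ->
  measurable_fun setT g -> (forall w, 0 <= g w)%E ->
  (\int[Pr]_w g w = \sum_(n <oo) \int[mrestr Pr (mA n)]_w g w)%E.
Proof.
move=> tA AT mg g0.
pose mA_ n : {measure set Om -> \bar R} := mrestr Pr (mA n).
rewrite -(ge0_integral_measure_series mA_ measurableT) //.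
apply: eq_measure_integral => B mB _.
rewrite /= /mseries /mrestr -[in LHS](setIT B) -AT setI_bigcupr.
apply: measure_semi_bigcup => //.
- by move=> n; exact: measurableI.
- exact: trivIset_setIl.
- by rewrite -setI_bigcupr AT setIT.
Qed.

End Restriction.

(** * The draws of an adaptive sample *)

Section Sampling.
Context {R : realType} {dO dX : measure_display}
  {Om : measurableType dO} {Xi : measurableType dX}.
Variables (Pr : probability Om R) (P : probability Xi R) (S : nat -> Om -> seq Xi).
Hypothesis S_sampling : adaptive_iid_sampling Pr P S.

(** Totalized with the default point of Xi beyond the size of the sample, so
that it is a random variable on the whole space. *)
Definition draw k i w : Xi := nth point (S k w) i.

(** The sample space with the sigma-algebra of the history, so that a function
is determined by the history when it is measurable out of this type. *)
Definition past k := g_sigma_algebraType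
  [set E : set Om | exists j i B,
     [/\ (j < k)%N, measurable B & E = draw_event S j i B]].

Lemma history_measurable k (A : set Om) : history S k A -> measurable A.
Proof.
apply: smallest_sub; first exact: sigma_algebra_measurable.
move=> _ [j [i [B [_ mB ->]]]]; exact: (sample_measurable S_sampling).
Qed.

Lemma historyS k (A : set Om) : history S k A -> history S k.+1 A.
Proof.
apply: sub_sigma_algebra2 => _ [j [i [B [jk mB ->]]]].
by exists j, i, B; split => //; exact: ltnW.
Qed.

Lemma measurable_past k dT (T : measurableType dT) (g : Om -> T) :
  measurable_fun (setT : set (past k)) g -> measurable_fun setT g.
Proof. by move=> mg _ B mB; apply: history_measurable; exact: mg. Qed.

Lemma measurable_to_past k : measurable_fun (setT : set Om) (id : Om -> past k).
Proof. exact: (@measurable_past k _ (past k) id (@measurable_id _ (past k) _)). Qed.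

Lemma measurable_pastS k dT (T : measurableType dT) (g : Om -> T) :
  measurable_fun (setT : set (past k)) g ->
  measurable_fun (setT : set (past k.+1)) g.
Proof. by move=> mg _ B mB; apply: historyS; exact: mg. Qed.

Lemma draw_eventE k i (B : set Xi) w :
  draw_event S k i B w <-> (i < size (S k w))%N /\ B (draw k i w).
Proof.
rewrite -onthTE /draw /draw_event /=; split=> [[xi Sxi Bxi]|].
  by rewrite Sxi (onth_nth point _ _ _ Sxi).
case Sxi : (onth (S k w) i) => [xi|] [// _].
by rewrite (onth_nth point _ _ _ Sxi) => Bxi; exists xi.
Qed.

Lemma draw_preimage k i (B : set Xi) : draw k i @^-1` B =
  draw_event S k i B `|` (~` draw_event S k i setT `&` [set _ | B point]).
Proof.
apply/seteqP; split=> w.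
- rewrite /preimage /= => Bw; have [iS|iS] := ltnP i (size (S k w)).
    by left; apply/draw_eventE.
  right; split=> [/draw_eventE[]|]; first by rewrite ltnNge iS.
  by move: Bw; rewrite /draw nth_default.
- case=> [/draw_eventE[]//|[niS Bp]]; rewrite /preimage /= /draw nth_default //.
  by rewrite leqNgt; apply/negP => iS; apply: niS; apply/draw_eventE.
Qed.

Lemma measurable_draw_past k i :
  measurable_fun (setT : set (past k.+1)) (draw k i).
Proof.
move=> _ B mB; rewrite setTI draw_preimage.
have mE C : measurable C -> measurable (draw_event S k i C : set (past k.+1)).
  by move=> mC; apply: sub_sigma_algebra; exists k, i, C.
apply: measurableU; first exact: mE.
apply: measurableI; first by apply: measurableC; exact: mE.
have [Bp|Bp] := pselect (B point).
  have -> : [set _ : Om | B point] = setT by apply/seteqP; split.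
  exact: measurableT.
have -> : [set _ : Om | B point] = set0 by apply/seteqP; split.
exact: measurable0.
Qed.

Lemma measurable_draw k i : measurable_fun setT (draw k i).
Proof. exact: (measurable_past (@measurable_draw_past k i)). Qed.

(** Indexed by the predecessor of the size, since samples are nonempty. *)
Definition of_size k n : set Om := [set w | size (S k w) = n.+1].

Lemma history_of_size k n : history S k (of_size k n).
Proof. exact: (sample_size_history S_sampling). Qed.

Lemma measurable_of_size k n : measurable (of_size k n).
Proof. exact: (history_measurable (@history_of_size k n)). Qed.

Lemma trivIset_of_size k : trivIset setT (of_size k).
Proof.
apply/trivIsetP => i j _ _ ij; apply/seteqP; split=> // w.
by rewrite /of_size => -[/= -> [ji]]; move: ij; rewrite ji eqxx.
Qed.

Lemma bigcup_of_size k : \bigcup_n of_size k n = setT.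
Proof.
apply/seteqP; split=> // w _; exists (size (S k w)).-1 => //=.
by rewrite /of_size /= prednK // (sample_nonempty S_sampling).
Qed.

Let m k n : {finite_measure set Om -> \bar R} := mrestr Pr (measurable_of_size k n).

(** The restriction to one sample size is carried by the measure, so A is an
arbitrary event of the history. *)
Lemma draws_iid k n (A : set Om) (B : 'I_n.+1 -> set Xi) :
  history S k A -> (forall i, measurable (B i)) ->
  m k n (A `&` [set w | forall i, B i (draw k i w)]) =
    (m k n A * \prod_(i < n.+1) P (B i))%E.
Proof.
move=> hA mB; have hAn : history S k (A `&` of_size k n).
  exact: (@measurableI _ (past k) _ _ hA (@history_of_size k n)).
rewrite /m /= /mrestr -(sample_iid S_sampling hAn) //.
congr (Pr _); apply/seteqP; split=> w /=.
  move=> [[Aw Bw] nw]; split=> // i; apply/draw_eventE; split => //.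
  by rewrite nw.
by move=> [[Aw nw] Bw]; split=> //; split=> // i; have /draw_eventE[] := Bw i.
Qed.

Lemma draw_fresh k n (i : 'I_n.+1) : fresh_draw (m k n) P (id : Om -> past k) (draw k i).
Proof.
move=> A C hA mC.
have := @draws_iid k n A (fun j => if j == i then C else setT) hA.
rewrite (bigD1 i) //= eqxx big1 ?mule1 => [<-|j /negbTE ->]; first last.
- exact: probability_setT.
- by move=> j; case: ifP.
rewrite preimage_id; congr (m k n (_ `&` _)); apply/seteqP; split=> w /= Cw.
  by move=> j; case: eqP => // ->.
by have := Cw i; rewrite eqxx.
Qed.

Lemma draw_fresh_pair k n (i j : 'I_n.+1) : i != j ->
  fresh_draw (m k n) P (fun w => (w : past k, draw k i w)) (draw k j).
Proof.
move=> ij; apply: fresh_draw_pair.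
- exact: measurable_to_past.
- exact: measurable_draw.
- exact: measurable_draw.
move=> A C E hA mC mE.
have := @draws_iid k n A
  (fun l => if l == i then C else if l == j then E else setT) hA.
rewrite (bigD1 i) //= eqxx (bigD1 j) //= 1?eq_sym // (negbTE ij) eqxx.
rewrite big1 ?mule1 ?muleA => [<-|l /andP[/negbTE -> /negbTE ->]]; first last.
- exact: probability_setT.
- by move=> l; case: ifP => // _; case: ifP.
rewrite preimage_id -setIA; congr (m k n (_ `&` _)); apply/seteqP; split=> w /=.
  by move=> [Cw Ew] l; case: eqP => [->//|_]; case: eqP => // ->.
move=> Hw; split; first by have := Hw i; rewrite eqxx.
by have := Hw j; rewrite eqxx eq_sym (negbTE ij).
Qed.

End Sampling.

(** * Measurability of the iterates *)

Section Gradients.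
Context {R : realType} {d : nat} {dX : measure_display} {Xi : measurableType dX}.
Variables (f : 'rV[R]_d -> Xi -> R).
Hypotheses (mf : forall q, measurable_fun setT (f q))
  (f_C1 : forall xi, C1 (fun q => f q xi)).

Lemma measurable_grad_at q j : measurable_fun setT (fun xi => grad_at f q xi 0 j).
Proof.
under eq_fun => xi do rewrite mxE.
apply: measurable_derive => // xi.
by apply: diff_derivable; have [] := f_C1 xi.
Qed.

Lemma measurable_grad_at_comp dT (T : measurableType dT) (q : T -> 'rV[R]_d)
    (y : T -> Xi) j :
  (forall i, measurable_fun setT (fun t => q t 0 i)) -> measurable_fun setT y ->
  measurable_fun setT (fun t => grad_at f (q t) (y t) 0 j).
Proof.
move=> mq my.
apply: (measurable_superposition (h := fun x t => grad_at f x (y t) 0 j)) => //.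
  by move=> x; exact: (measurableT_comp (measurable_grad_at x j) my).
move=> t x; have [_ /(_ x) cg] := f_C1 (y t).
exact: (cvg_comp _ _ cg (@coord_continuous R 1 d 0 j _)).
Qed.

End Gradients.

Lemma measurable_continuous_comp {R : realType} {d : nat} dT (T : measurableType dT)
    (g : 'rV[R]_d -> R) (q : T -> 'rV[R]_d) : continuous g ->
  (forall i, measurable_fun setT (fun t => q t 0 i)) ->
  measurable_fun setT (fun t => g (q t)).
Proof.
by move=> cg mq; apply: (measurable_superposition (h := fun x _ => g x)).
Qed.

Section Iterates.
Context {R : realType} {d : nat} {dO dX : measure_display}
  {Om : measurableType dO} {Xi : measurableType dX}.
Variables (Pr : probability Om R) (P : probability Xi R) (S : nat -> Om -> seq Xi)
  (f : 'rV[R]_d -> Xi -> R) (al : R) (x0 : 'rV[R]_d) (x : nat -> Om -> 'rV[R]_d).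
Hypotheses (S_sampling : adaptive_iid_sampling Pr P S)
  (mf : forall q, measurable_fun setT (f q))
  (f_C1 : forall xi, C1 (fun q => f q xi))
  (x_init : forall w, x 0%N w = x0)
  (x_step : forall k w, x k.+1 w = x k w - al *: sample_grad f (S k w) (x k w)).

Lemma sample_grad_draw k n w : of_size S k n w -> sample_grad f (S k w) (x k w) =
  n.+1%:R^-1 *: \sum_(i < n.+1) grad_at f (x k w) (draw S k i w).
Proof.
rewrite /of_size /sample_grad /= => nw; rewrite nw; congr (_ *: _).
by rewrite (big_nth point) nw big_mkord.
Qed.

(** The iterate of index k.+1 is determined by that of index k and the k-th
sample; on each value of the size of the latter, the sampled gradient is a
finite sum of superpositions, and these events lie in the history. *)
Lemma measurable_iterate k j :
  measurable_fun (setT : set (past S k)) (fun w => x k w 0 j).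
Proof.
elim: k j => [|k IH] j.
  apply: (eq_measurable_fun (T1 := past S 0) (cst (x0 0 j))) => [w _|//].
  by rewrite x_init.
have IH' i : measurable_fun (setT : set (past S k.+1)) (fun w => x k w 0 i).
  exact: measurable_pastS.
rewrite -(bigcup_of_size S_sampling k).
have mof n : measurable (of_size S k n : set (past S k.+1)).
  by apply: historyS; exact: (history_of_size S_sampling).
apply/measurable_fun_bigcup => // n.
apply: (eq_measurable_fun (T1 := past S k.+1) (fun w => (x k w +
  (- al) *: (n.+1%:R^-1 *: \sum_(i < n.+1) grad_at f (x k w) (draw S k i w))) 0 j)).
  by move=> w; rewrite inE => nw; rewrite x_step (sample_grad_draw nw) scaleNr.
apply: (@measurable_funTS _ _ (past S k.+1)).
apply: measurable_coordD => // {}j.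
apply: measurable_coordZ => // {}j; apply: measurable_coordZ => // {}j.
apply: measurable_coord_sum => i {}j; apply: measurable_grad_at_comp => //.
exact: measurable_draw_past.
Qed.

End Iterates.

(** * Linear convergence in expectation *)

Section Contraction.
Context {R : realType} {d : nat} {dO dX : measure_display}
  {Om : measurableType dO} {Xi : measurableType dX}.
Variables (Pr : probability Om R) (P : probability Xi R) (S : nat -> Om -> seq Xi)
  (f : 'rV[R]_d -> Xi -> R) (al : R) (x0 : 'rV[R]_d) (x : nat -> Om -> 'rV[R]_d)
  (F : 'rV[R]_d -> R) (xstar : 'rV[R]_d) (mu L theta nu : R).
Hypotheses (S_sampling : adaptive_iid_sampling Pr P S)
  (mf : forall q, measurable_fun setT (f q))
  (f_C1 : forall xi, C1 (fun q => f q xi))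
  (grad_unbiased : forall q j,
     ('E_P[fun xi => (grad_at f q xi 0 j)%R] = (gradient F q 0 j)%:E)%E)
  (grad_moment2 : forall q,
     ('E_P[fun xi => (l2norm (grad_at f q xi) ^+ 2)%R] < +oo)%E)
  (mu_gt0 : 0 < mu) (L_gt0 : 0 < L) (F_C2 : C2 F)
  (F_convex : forall q, loewner_le mu%:M (hessian F q))
  (F_smooth : forall q, loewner_le (hessian F q) L%:M)
  (xstar_min : forall q, F xstar <= F q)
  (x_init : forall w, x 0%N w = x0)
  (x_step : forall k w, x k.+1 w = x k w - al *: sample_grad f (S k w) (x k w))
  (S_inner_product : forall k, {ae Pr, forall w,
     inner_product_test P f F theta (x k w) (size (S k w))})
  (S_orthogonality : forall k, {ae Pr, forall w,
     orthogonality_test P f F nu (x k w) (size (S k w))})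
  (al_gt0 : 0 < al) (al_le : al * L * (1 + (theta ^+ 2 + nu ^+ 2)) <= 1).

Let gap k w : R := F (x k w) - F xstar.

Let gap_ge0 k w : 0 <= gap k w.
Proof. by rewrite subr_ge0. Qed.

Let mx k j : measurable_fun (setT : set (past S k)) (fun w => x k w 0 j).
Proof. exact: (measurable_iterate S_sampling mf f_C1 x_init x_step). Qed.

Let F_continuous : continuous F.
Proof. by have [dF _ _] := F_C2 => q; exact: differentiable_continuous. Qed.

Let gradient_continuous j : continuous (fun q => gradient F q 0 j).
Proof.
have [_ dG _] := F_C2 => q.
exact: (cvg_comp _ _ (differentiable_continuous (dG q))
  (@coord_continuous R 1 d 0 j _)).
Qed.

Let mgap_past k : measurable_fun (setT : set (past S k)) (gap k).
Proof.
by apply: measurable_funB => //; exact: measurable_continuous_comp.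
Qed.

Let mgap k : measurable_fun setT (gap k).
Proof. exact: (measurable_past S_sampling (@mgap_past k)). Qed.

Let G k (u : past S k) := gradient F (x k u).

Let mG k j : measurable_fun setT (fun u => @G k u 0 j).
Proof.
exact: (measurable_continuous_comp (@gradient_continuous j) (@mx k)).
Qed.

Let D k (u : past S k) (y : Xi) := grad_at f (x k u) y - @G k u.

Let mD k j : measurable_fun setT (fun p : past S k * Xi => @D k p.1 p.2 0 j).
Proof.
have mGp i : measurable_fun setT (fun p : past S k * Xi => (- @G k p.1) 0 i).
  apply: (eq_measurable_fun (fun p : past S k * Xi => - @G k p.1 0 i)).
    by move=> p _; rewrite [RHS]mxE.
  by apply: measurable_funN; exact: (measurableT_comp (@mG k i) measurable_fst).
apply: measurable_coordD => // i; apply: measurable_grad_at_comp => // l.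
exact: (measurableT_comp (@mx k l) measurable_fst).
Qed.

Let m k n : {finite_measure set Om -> \bar R} :=
  mrestr Pr (measurable_of_size S_sampling k n).

Let D_moment k n : {ae m k n, forall w, (\int[P]_y (dot (@D k w y) (@D k w y))%:E
     <= (n.+1%:R * (theta ^+ 2 + nu ^+ 2) * dot (@G k w) (@G k w))%:E)%E}.
Proof.
apply: (@ae_mrestr _ _ _ Pr (of_size S k n)).
apply: filterS2 (S_inner_product k) (S_orthogonality k) => w ip orth nw.
apply: deviation_le => //.
- by move=> j; exact: measurable_grad_at.
- by rewrite -nw.
- by rewrite -nw.
Qed.

Let integral_gap k j : (\int[Pr]_w (gap j w)%:E =
  \sum_(n <oo) \int[m k n]_w (gap j w)%:E)%E.
Proof.
apply: ge0_integral_partition.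
- exact: trivIset_of_size.
- exact: (bigcup_of_size S_sampling).
- exact/measurable_EFinP.
- by move=> w; rewrite lee_fin.
Qed.

Let N k n w := mean_noise (id : Om -> past S k)
  (fun (i : 'I_n.+1) w => draw S k i w) (@D k) w.

Let iterate_noise k n w : of_size S k n w ->
  x k.+1 w = x k w - al *: (@G k w + @N k n w).
Proof.
move=> nw; rewrite x_step (sample_grad_draw _ _ nw) /N /mean_noise /D.
congr (_ - _ *: _); rewrite sumrB sumr_const card_ord scalerBr.
rewrite -(scaler_nat n.+1 (G w)) scalerA.
by rewrite mulVf ?pnatr_eq0 // scale1r addrC subrK.
Qed.

(* The contraction on the event of size n.+1. The function h' below is the next
   gap written with the n.+1 first draws; it is defined and nonnegative
   everywhere, and agrees with the next gap on that event. *)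
Let integral_gap_le k n : (m k n).-integrable setT (EFin \o gap k) ->
  (\int[m k n]_w (gap k.+1 w)%:E <= (1 - mu * al)%:E * \int[m k n]_w (gap k w)%:E)%E.
Proof.
move=> igap.
have mxO j : measurable_fun (setT : set Om) (fun w => x k w 0 j).
  exact: (measurable_past S_sampling (@mx k j)).
have mU : measurable_fun (setT : set Om) (id : Om -> past S k).
  exact: (measurable_to_past S_sampling).
have mGO j : measurable_fun (setT : set Om) (fun w => @G k w 0 j).
  exact: (measurable_past S_sampling (@mG k j)).
have GG w : dot (@G k w) (@G k w) <= 2 * L * gap k w.
  exact: gradient_le_gap.
have iGG : (m k n).-integrable setT (EFin \o fun w => dot (@G k w) (@G k w)).
  apply: (le_integrable _ _ _ (integrableZl measurableT (2 * L) igap)) => // [|w _].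
    by apply/measurable_EFinP; exact: measurable_dot.
  have gap2_ge0 : 0 <= 2 * L * gap k w by rewrite mulr_ge0 // mulr_ge0 // ltW.
  rewrite -EFinM lee_fin /= ger0_norm ?dot_ge0 // ger0_norm //.
pose h' w := F (x k w - al *: (@G k w + @N k n w)) - F xstar.
have mN j : measurable_fun (setT : set Om) (fun w => @N k n w 0 j).
  apply: (measurable_mean_noise mU) => [i|l]; last exact: mD.
  exact: (measurable_draw S_sampling).
have mh' : measurable_fun setT h'.
  apply: measurable_funB => //; apply: measurable_continuous_comp => // j.
  under eq_fun => w do rewrite -scaleNr.
  apply: measurable_coordD => // {}j; apply: measurable_coordZ => // {}j.
  exact: measurable_coordD.
apply: (@le_trans _ _ (\int[m k n]_w (h' w)%:E)%E).
  apply: ae_ge0_le_integral => //.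
  - by move=> w _; rewrite lee_fin.
  - exact/measurable_EFinP.
  - by move=> w _; rewrite lee_fin subr_ge0.
  - exact/measurable_EFinP.
  - apply: (@ae_mrestr _ _ _ Pr (of_size S k n)); apply: nearW => w nw _.
    by rewrite /gap /h' (iterate_noise nw).
have mY (i : 'I_n.+1) : measurable_fun setT (draw S k i).
  exact: (measurable_draw S_sampling).
have c_ge0 : 0 <= theta ^+ 2 + nu ^+ 2 by rewrite addr_ge0 // sqr_ge0.
have centered u v : (\int[P]_y (dot v (@D k u y))%:E = 0)%E.
  by apply: integral_dot_centered => // j; exact: measurable_grad_at.
apply: (expected_descent (ltn0Sn n) c_ge0 mU mY
  (@draw_fresh _ _ _ _ _ _ _ _ S_sampling k n)
  (@draw_fresh_pair _ _ _ _ _ _ _ _ S_sampling k n)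
  (@mG k) (@mD k) centered (@D_moment k n) iGG mu_gt0 L_gt0 al_gt0 al_le mh' _ igap).
- by move=> w; rewrite subr_ge0.
- by move=> w; exact: polyak_lojasiewicz.
- move=> w; set v := @G k w + @N k n w.
  have := quadratic_upper_bound F_C2 (x k w) (x k w - al *: v) F_smooth.
  have -> : x k w - al *: v - x k w = - (al *: v) by rewrite addrC addKr.
  rewrite /h' /gap -/(@G k w) -/v !dotNr dotNl opprK !dotZr dotZl; lra.
Qed.

(** Finiteness of the expected gap at step k provides the integrability on each
size; the condition on mu * al lets the factor go through the series. *)
Lemma expected_gap_contracts k : mu * al <= 1 -> (\int[Pr]_w (gap k w)%:E < +oo)%E ->
  (\int[Pr]_w (gap k.+1 w)%:E <= (1 - mu * al)%:E * \int[Pr]_w (gap k w)%:E)%E.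
Proof.
move=> mual gap_fin.
have int_ge0 n j : (0 <= \int[m k n]_w (gap j w)%:E)%E.
  by apply: integral_ge0 => w _; rewrite lee_fin.
have igap n : (m k n).-integrable setT (EFin \o gap k).
  apply/integrableP; split; first exact/measurable_EFinP.
  under eq_integral => w _ do rewrite /= ger0_norm //.
  apply: le_lt_trans gap_fin; rewrite (integral_gap k).
  apply: le_trans (nneseries_lim_ge n.+1 _) => //.
  rewrite big_mkord big_ord_recr /=; apply: leeDr.
    by apply: sume_ge0 => i _; exact: int_ge0.
rewrite !(integral_gap k) -nneseriesZl //; apply: lee_nneseries => // n _.
exact: integral_gap_le.
Qed.

End Contraction.

Theorem theorem3p2 (R : realType) (d : nat)
  (dX : measure_display) (Xi : measurableType dX) (P : probability Xi R)
  (dO : measure_display) (Omega : measurableType dO) (Pr : probability Omega R)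
  (f : 'rV[R]_d -> Xi -> R) (F : 'rV[R]_d -> R)
  (f_smooth : forall xi, C1 (fun x => f x xi))
  (f_integrable : forall x, P.-integrable [set: Xi] (EFin \o f x))
  (F_risk : forall x, ('E_P[f x] = (F x)%:E)%E)
  (grad_unbiased : forall x j,
     ('E_P[fun xi => (grad_at f x xi 0 j)%R] = (gradient F x 0 j)%:E)%E)
  (grad_moment2 : forall x,
     ('E_P[fun xi => (l2norm (grad_at f x xi) ^+ 2)%R] < +oo)%E)
  (mu L : R) (mu_gt0 : 0 < mu) (mu_le_L : mu <= L)
  (F_C2 : C2 F)
  (F_hessian : forall x,
     loewner_le mu%:M (hessian F x) /\ loewner_le (hessian F x) L%:M)
  (xstar : 'rV[R]_d) (xstar_min : forall x, F xstar <= F x)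
  (S : nat -> Omega -> seq Xi) (S_sampling : adaptive_iid_sampling Pr P S)
  (alpha_ : nat -> R) (alpha_gt0 : forall k, 0 < alpha_ k)
  (x0 : 'rV[R]_d) (x : nat -> Omega -> 'rV[R]_d)
  (x_init : forall w, x 0%N w = x0)
  (x_step : forall k w,
     x k.+1 w = x k w - alpha_ k *: sample_grad f (S k w) (x k w))
  (theta nu : R) (theta_gt0 : 0 < theta) (nu_gt0 : 0 < nu)
  (S_inner_product : forall k, {ae Pr, forall w,
     inner_product_test P f F theta (x k w) (size (S k w))})
  (S_orthogonality : forall k, {ae Pr, forall w,
     orthogonality_test P f F nu (x k w) (size (S k w))})
  (alpha : R) (alpha_const : forall k, alpha_ k = alpha)
  (alpha_le : alpha <= 1 / ((1 + theta ^+ 2 + nu ^+ 2) * L)) :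
  let rho := 1 - mu * alpha in
  (forall k, ('E_Pr[fun w => (F (x k w) - F xstar)%R]
              <= (rho ^+ k * (F x0 - F xstar))%:E)%E) /\
  (alpha = 1 / ((1 + theta ^+ 2 + nu ^+ 2) * L) ->
   rho = 1 - mu / (L * (1 + theta ^+ 2 + nu ^+ 2))).
Proof.
move=> rho; split=> [k|alphaE]; last by rewrite /rho alphaE mulrA mulr1 (mulrC L).
have L_gt0 : 0 < L := lt_le_trans mu_gt0 mu_le_L.
have al_gt0 : 0 < alpha by rewrite -(alpha_const 0%N).
have al_le : alpha * L * (1 + (theta ^+ 2 + nu ^+ 2)) <= 1.
  have K0 : 0 < (1 + theta ^+ 2 + nu ^+ 2) * L.
    by rewrite mulr_gt0 // -addrA ltr_pwDl // addr_ge0 // sqr_ge0.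
  by move: alpha_le; rewrite ler_pdivlMr //; nra.
have mual : mu * alpha <= 1.
  have : alpha * mu <= alpha * L by rewrite ler_pM2l.
  have := sqr_ge0 theta; have := sqr_ge0 nu; have := mulr_gt0 al_gt0 L_gt0.
  by nra.
have mf q : measurable_fun setT (f q).
  by apply/measurable_EFinP; exact: (measurable_int P (f_integrable q)).
have x_step' i w : x i.+1 w = x i w - alpha *: sample_grad f (S i w) (x i w).
  by rewrite x_step alpha_const.
rewrite unlock.
elim: k => [|k IH].
  under eq_integral => w _ do rewrite x_init.
  by rewrite integral_cst // [X in (_ * X)%E]probability_setT mule1 expr0 mul1r.
have gap_fin : (\int[Pr]_w (F (x k w) - F xstar)%:E < +oo)%E.
  exact: le_lt_trans IH (ltry _).
apply: le_trans (expected_gap_contracts S_sampling mf f_smooth grad_unbiased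
  grad_moment2 mu_gt0 L_gt0 F_C2 (fun q => (F_hessian q).1)
  (fun q => (F_hessian q).2) xstar_min x_init x_step' S_inner_product
  S_orthogonality al_gt0 al_le mual gap_fin) _.
rewrite exprS -mulrA EFinM; apply: lee_wpmul2l => //.
by rewrite lee_fin subr_ge0.
Qed.
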